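(* Let $L$ be a finite-dimensional complex semisimple Leibniz algebra, let $I$ be the ideal of $L$ generated by squares, and suppose that the quotient algebra $L/I$ is isomorphic to a simple Lie algebra $G$; write $L=G\dot{+}I$ as a vector space direct sum with $G$ identified with a Lie subalgebra of $L$. Then any derivation $d$ of $L$ can be represented as $d=R_a+\alpha+\triangle$, where $a\in G$, $\alpha: I\to I$ and $\triangle: G\to I$ are linear maps (extended to $L$ by $\alpha|_G=0$ and $\triangle|_I=0$), and $\alpha([x,y])=[\alpha(x),y]$ for all $x,y\in L$. Moreover, $I$, regarded as a right $G$-module via $(x,g)\mapsto[x,g]$, is a direct sum $I=\bigoplus_{i=1}^s I_i$ of irreducible $G$-modules $I_i$, and $\alpha=\sum_{i,j=1}^{s}\alpha_{i,j}$, where $\alpha_{i,j}: I_i\to I_j$ ($1\leq i,j\leq s$) is the component of $\alpha|_{I_i}$ in $I_j$, and $\alpha_{i,i}=\lambda_i\,\mathrm{id}_{I_i}$ for some $\lambda_i\in\mathbb{C}$, $1\leq i\leq s$.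
   Context: A (right) Leibniz algebra over a field $F$ is an $F$-vector space $L$ with a bilinear product $[\cdot,\cdot]$ satisfying $[x,[y,z]]=[[x,y],z]-[[x,z],y]$ for all $x,y,z\in L$. Ideals are two-sided. $I$ denotes the ideal of $L$ generated by the squares $[x,x]$, $x\in L$; it coincides with the linear span of the squares, $[L,I]=0$, and $L/I$ is a Lie algebra. The derived sequence is $L^{[1]}=L$, $L^{[k+1]}=[L^{[k]},L^{[k]}]$, and $L$ is solvable if $L^{[s]}=0$ for some $s$; the solvable radical is the maximal solvable ideal. $L$ is called semisimple if its solvable radical equals $I$. By the Levi-type theorem for Leibniz algebras (Barnes), a finite-dimensional semisimple Leibniz algebra in characteristic zero has a decomposition $L=G\dot{+}I$ with $G$ a semisimple Lie subalgebra, $G\cong L/I$. A derivation of $L$ is a linear map $d:L\to L$ with $d([x,y])=[d(x),y]+[x,d(y)]$ for all $x,y\in L$. For $a\in L$, $R_a:L\to L$ is the right multiplication operator $R_a(x)=[x,a]$. *)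

(* Defs.v *)
From mathcomp Require Import all_boot all_algebra.
From mathcomp Require Import sesquilinear.

Set Implicit Arguments.
Unset Strict Implicit.
Unset Printing Implicit Defensive.

Import GRing.Theory.
Local Open Scope ring_scope.

Section Leibniz.

Variables (F : fieldType) (L : vectType F) (br : {bilinear L -> L -> L}).
Implicit Types A G I J M N U V W : {vspace L}.

Definition right_leibniz : Prop :=
  forall x y z : L, br x (br y z) = br (br x y) z - br (br x z) y.

(* Span of all [br u v], u in U, v in V (see [brv_leP]), encoded as [prodv]
   is for the product of an algebra. *)
Definition brv U V : {vspace L} :=
  <<[seq br u v | u <- vbasis U, v <- vbasis V]>>%VS.

Lemma brv_leP U V W :
  (brv U V <= W)%VS <-> (forall u v, u \in U -> v \in V -> br u v \in W).
Proof.
split=> [/span_subvP sW u v uU vV | sW]; last first.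
  apply/span_subvP => _ /allpairsP[[u v] /= [uU vV ->]].
  by apply: sW; exact: vbasis_mem.
rewrite (coord_vbasis uU) (coord_vbasis vV) linear_sumr.
apply: memv_suml => j _; rewrite linearZr_LR; apply: memvZ.
rewrite linear_sumlz; apply: memv_suml => i _; rewrite linearZl_LR; apply: memvZ.
by apply/sW/allpairsP; exists ((vbasis U)`_i, (vbasis V)`_j);
  split=> //; apply: memt_nth.
Qed.

(* Two-sided ideal of the algebra carried by the subspace A. *)
Definition ideal_of A J : Prop :=
  (J <= A)%VS /\
  forall x y, x \in A -> y \in J -> br x y \in J /\ br y x \in J.

Definition ideal J : Prop := ideal_of fullv J.

(* I is the ideal of L generated by the squares. *)
Definition squares_ideal I : Prop :=
  [/\ ideal I, forall x, br x x \in I &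
      forall J, ideal J -> (forall x, br x x \in J) -> (I <= J)%VS].

(* [derived J k] is J^[k+1], since J^[1] = J. *)
Definition derived J (k : nat) : {vspace L} := iter k (fun U => brv U U) J.

Definition solvable J : Prop := exists k, derived J k = 0%VS.

Definition solvable_radical J : Prop :=
  [/\ ideal J, solvable J &
      forall J', ideal J' -> solvable J' -> (J' <= J)%VS].

Definition semisimple_leibniz : Prop :=
  exists2 I, squares_ideal I & solvable_radical I.

Definition lie_subalgebra G : Prop :=
  [/\ forall x y, x \in G -> y \in G -> br x y \in G,
      forall x, x \in G -> br x x = 0 &
      forall x y z, x \in G -> y \in G -> z \in G ->
        br x (br y z) + br y (br z x) + br z (br x y) = 0].

Definition simple_lie_subalgebra G : Prop :=
  [/\ lie_subalgebra G,
      exists x y, [/\ x \in G, y \in G & br x y != 0] &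
      forall J, ideal_of G J -> J = 0%VS \/ J = G].

Definition complementary G I : Prop :=
  (G + I)%VS = fullv /\ (G :&: I)%VS = 0%VS.

(* The projection onto a subalgebra G along a complementary ideal I is a
   homomorphism onto G with kernel I: it induces L/I ~ G. *)
Lemma complement_quotient G I :
    ideal I -> complementary G I ->
    (forall x y, x \in G -> y \in G -> br x y \in G) ->
  [/\ forall x y, daddv_pi G I (br x y) =
        br (daddv_pi G I x) (daddv_pi G I y),
      limg (daddv_pi G I) = G & lker (daddv_pi G I) = I].
Proof.
move=> [_ idI] [GI GI0] sG.
have IG0 : (I :&: G)%VS = 0%VS by rewrite capvC.
have dec x : daddv_pi G I x + daddv_pi I G x = x.
  by apply: daddv_pi_add => //; rewrite GI memvf.
have piG x : daddv_pi G I x \in G by apply: memv_pi.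
have piI x : daddv_pi I G x \in I by apply: memv_pi.
have pi0 x : x \in I -> daddv_pi G I x = 0.
  move=> xI; apply: (addIr (daddv_pi I G x)).
  by rewrite dec add0r daddv_pi_id.
split.
- move=> x y; rewrite -{1}(dec x) -{1}(dec y).
  set g := daddv_pi G I x; set i := daddv_pi I G x.
  set h := daddv_pi G I y; set j := daddv_pi I G y.
  rewrite linearDl linearDr -addrA linearD /= daddv_pi_id ?sG ?piG //.
  rewrite [X in _ + X]pi0 ?addr0 // memvD //.
    by have [] := idI g j (memvf _) (piI y).
  by have [] := idI (h + j) i (memvf _) (piI x).
- apply/vspaceP => x; apply/idP/idP => [/memv_imgP[u _ ->] | xG] //.
  by apply/memv_imgP; exists x; rewrite ?memvf // daddv_pi_id.
- apply/vspaceP => x; rewrite memv_ker.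
  apply/eqP/idP => [x0 | /pi0 //].
  by rewrite -(dec x) x0 add0r.
Qed.

Definition derivation (d : 'End(L)) : Prop :=
  forall x y, d (br x y) = br (d x) y + br x (d y).

Definition right_mul (a : L) : L -> L := fun x => br x a.

(* d = R_a + alpha + delta, where alpha : I -> I and delta : G -> I are
   extended by 0 to L. *)
Definition derivation_rep G I (d : 'End(L)) (a : L) (alpha delta : 'End(L)) :
    Prop :=
  [/\ a \in G,
      (forall x, x \in I -> alpha x \in I) /\
      (forall x, x \in G -> alpha x = 0),
      (forall x, x \in G -> delta x \in I) /\
      (forall x, x \in I -> delta x = 0),
      forall x, d x = right_mul a x + alpha x + delta x &
      forall x y, alpha (br x y) = br (alpha x) y].

Definition right_submodule G M : Prop :=
  forall x g, x \in M -> g \in G -> br x g \in M.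

Definition irreducible_module G M : Prop :=
  [/\ right_submodule G M, M <> 0%VS &
      forall N, (N <= M)%VS -> right_submodule G N -> N = 0%VS \/ N = M].

Definition irreducible_decomposition G I (s : nat) (Is : 'I_s -> {vspace L}) :
    Prop :=
  [/\ (\sum_(i < s) Is i)%VS = I, directv (\sum_(i < s) Is i) &
      forall i, irreducible_module G (Is i)].

(* alpha_ i j : Is i -> Is j, extended by 0 to G and to the other summands;
   as the sum of the Is is direct, the last clause says that alpha_ i j is the
   component in Is j of the restriction of alpha to Is i. *)
Definition components G (s : nat) (Is : 'I_s -> {vspace L}) (alpha : 'End(L))
    (alpha_ : 'I_s -> 'I_s -> 'End(L)) : Prop :=
  [/\ forall i j x, x \in Is i -> alpha_ i j x \in Is j,
      forall i j k x, k != i -> x \in Is k -> alpha_ i j x = 0,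
      forall i j x, x \in G -> alpha_ i j x = 0 &
      alpha = \sum_(i < s) \sum_(j < s) alpha_ i j].

End Leibniz.

(* Main.v *)
(* The right multiplications by elements of I vanish, so a derivation d induces
   a derivation of G = L/I. Whitehead's first lemma for the simple Lie algebra
   G makes it inner, d = R_a modulo I on G, and the Leibniz identity then says
   that d - R_a commutes with the right action of L on I; this is alpha, and
   its blocks alpha_(i, i) are scalars by Schur's lemma. Complete reducibility
   of I is Whitehead's lemma again, for the cocycle x |-> [R_x, p] where p is a
   linear projection onto a submodule.

   Whitehead's lemma: the Casimir element C of a nonzero representation
   commutes with the action and has nonzero trace, and C f is a coboundary for
   every cocycle f. Hence f is a coboundary on the Fitting component of C where
   C is invertible, and one concludes by induction on the other component.

   The Casimir element exists because the trace form is nondegenerate. Were it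
   zero, then for X = rho x with spectral idempotents E_mu, the commutators of
   S = sum_mu conj(mu) E_mu with rho G stay in rho G, whence tr (X S) = 0 since
   G = [G, G]; this trace is sum_mu |mu|^2 rank E_mu, so X is nilpotent. Then G
   is ad-nilpotent, hence has an ideal of codimension 1 (Engel), which a simple
   Lie algebra has not. *)

Require Import Defs.
From HB Require Import structures.
From mathcomp Require Import all_boot all_order all_algebra.
From mathcomp Require Import sesquilinear reals complex.
From mathcomp Require Import boolp ring zify.

Set Implicit Arguments.
Unset Strict Implicit.
Unset Printing Implicit Defensive.

Import Order.TTheory GRing.Theory Num.Theory VectorInternalTheory.
Local Open Scope ring_scope.

(** * Fitting and spectral idempotents *)

(** Induction on the size through the rank factorization [A = C R]: [\tr (C R) = \tr (R C)], and the
    smaller matrix [R C] is again nilpotent because [C (R C)^j R = A^(j+1)], where [C] and [R] can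
    be cancelled. A nilpotent matrix of full rank has size 0. *)
Lemma mxtrace_nilpotent (F : fieldType) n (A : 'M[F]_n) k :
  A ^+ k = 0 -> \tr A = 0.
Proof.
have [m] := ubnP n; elim: m n A k => // m IHm n A k lt_nm Ak0.
have [rA | rA] := eqVneq (\rank A) n.
  case: n A lt_nm Ak0 rA => [|n] A _ Ak0 rA; first by rewrite flatmx0 mxtrace0.
  have Au : A \is a GRing.unit
    by rewrite -[_ \is a _]row_full_unit /row_full rA.
  by have := unitrX k Au; rewrite Ak0 unitr0.
have lt_rn : (\rank A < n)%N by rewrite ltn_neqAle rA rank_leq_row.
rewrite -(mulmx_base A) mxtrace_mulC; apply: (IHm _ _ k);
  first exact: leq_trans lt_rn _.
have XB j : col_base A *m (row_base A *m col_base A) ^+ j *m row_base A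
  = A ^+ j.+1.
  elim: j => [|j IHj]; first by rewrite expr0 mulmx1 mulmx_base expr1.
  rewrite exprSr [RHS]exprSr -IHj -[X in _ = _ * X]mulmx_base -!mulmxE !mulmxA.
  by [].
apply: (row_full_inj (col_base_full A));
  apply: (row_free_inj (row_base_free A)).
by rewrite XB exprS Ak0 mulr0 mulmx0 mul0mx.
Qed.

(** In a rank factorization [A = C R], cancelling [C] and [R] in [A A = A] leaves [R C = 1], of size
    the rank of [A]. *)
Lemma mxtrace_idempotent (F : fieldType) n (A : 'M[F]_n) :
  A *m A = A -> \tr A = (\rank A)%:R.
Proof.
move=> AA; rewrite -{1}(mulmx_base A) mxtrace_mulC -mxtrace1.
congr (\tr _).
apply: (row_full_inj (col_base_full A));
  apply: (row_free_inj (row_base_free A)).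
by rewrite [RHS]/= mulmx1 (mulmx_base A) -mulmxA -(mulmxA _ (col_base A))
  mulmxA !(mulmx_base A).
Qed.

(* E is the projection onto the nilpotent part of the Fitting decomposition
   of A; A is invertible on the other part, with partial inverse U. *)
Lemma fitting_idempotent (F : fieldType) n (A : 'M[F]_n.+1) :
  exists EU : 'M[F]_n.+1 * 'M[F]_n.+1,
    [/\ EU.1 * EU.1 = EU.1, A ^+ n.+1 * EU.1 = 0, 1 - EU.1 = A * EU.2 &
        forall B, GRing.comm A B -> GRing.comm EU.1 B /\ GRing.comm EU.2 B].
Proof.
have [k [q]] := multiplicity_XsubC (char_poly A) 0.
rewrite monic_neq0 ?char_poly_monic //= subr0 => q0 charA.
have le_kn : (k <= n.+1)%N.
  have q_neq0 : q != 0 by apply: contraNneq q0 => ->; rewrite root0.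
  have := size_char_poly A.
  rewrite charA size_Mmonic ?monicXn // size_polyXn addnS /= => sz.
  by rewrite -ltnS -sz -[k.+1]add1n leq_add2r size_poly_gt0.
have cop : coprimep ('X^(n.+1)) q.
  by apply: coprimep_expl; rewrite coprimep_sym; have := coprimep_XsubC q 0;
    rewrite subr0 => ->.
have [[u v] /= uv1'] := Bezout_eq1_coprimepP _ _ cop.
have uv1 : u * 'X^(n.+1) + v * q = 1 := uv1'.
have zeroP p : horner_mx A (q * 'X^(n.+1) * p) = 0.
  rewrite -(subnK le_kn) addnC exprD mulrA -charA !rmorphM /=.
  by rewrite Cayley_Hamilton !mul0r.
(* With the characteristic polynomial equal to [q X^k] and [u X^(n+1) + v q = 1], the idempotent is
   [(v q)(A)]; its complement [(u X^(n+1))(A)] is divisible by [A]. Being polynomials in [A], both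
   matrices commute with whatever commutes with [A]. *)
exists (horner_mx A (v * q), horner_mx A (u * 'X^n)).
have hX : horner_mx A 'X^(n.+1) = A ^+ n.+1 by rewrite rmorphXn /= horner_mx_X.
split=> /=.
- rewrite -rmorphM /= -[RHS]addr0 -[X in _ + X](zeroP (- (u * v))) -rmorphD /=.
  congr horner_mx; move: ('X^(n.+1)) uv1 => X /(congr1 ( *%R (v * q))).
  rewrite mulr1 => {3}<-; ring.
- rewrite -hX -rmorphM /= -[RHS](zeroP v); congr horner_mx; ring.
- transitivity (horner_mx A ('X * (u * 'X^n)));
  last by rewrite rmorphM /= horner_mx_X.
  by rewrite mulrCA -exprS -[u * _](addrK (v * q)) uv1 rmorphB rmorph1.
- by move=> B AB; split; apply: comm_horner_mx.
Qed.

Lemma comm_sub_scalar (F : fieldType) n (X B : 'M[F]_n.+1) mu :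
  GRing.comm X B -> GRing.comm (X - mu%:A) B.
Proof.
move=> XB; apply/commr_sym/commrB; first exact: commr_sym.
by rewrite /GRing.comm -scalerAl -scalerAr mul1r mulr1.
Qed.

(** [E mu] is the Fitting idempotent of [X - mu]. Distinct ones are orthogonal because powers of
    [X - mu] and [X - nu] are coprime. *)
Lemma spectral_idempotents (F : closedFieldType) n (X : 'M[F]_n.+1) :
  exists (rs : seq F) (E : F -> 'M[F]_n.+1),
    [/\ uniq rs /\ \sum_(mu <- rs) E mu = 1,
        forall mu, E mu * E mu = E mu,
        forall mu nu, mu != nu -> E mu * E nu = 0,
        forall mu, GRing.comm X (E mu) &
        forall mu, (X - mu%:A) ^+ n.+1 * E mu = 0].
Proof.
have [EU EUP] := boolp.choice (fun mu => fitting_idempotent (X - mu%:A)).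
pose E mu := (EU mu).1; pose U mu := (EU mu).2.
have EE mu : E mu * E mu = E mu by have [] := EUP mu.
have nilE mu : (X - mu%:A) ^+ n.+1 * E mu = 0 by have [] := EUP mu.
have EC mu : 1 - E mu = (X - mu%:A) * U mu by have [] := EUP mu.
have commE mu B : GRing.comm X B -> GRing.comm (E mu) B /\ GRing.comm (U mu) B.
  by move=> /(comm_sub_scalar mu) XB; have [_ _ _ /(_ B XB)] := EUP mu.
have XE mu : GRing.comm X (E mu) by apply/commr_sym/(commE _ _ _).1.
have XU mu : GRing.comm X (U mu) by apply/commr_sym/(commE _ _ _).2.
have E0 mu nu : mu != nu -> E mu * E nu = 0.
  move=> neq; have cop : coprimep (('X - mu%:P) ^+ n.+1) (('X - nu%:P) ^+ n.+1).
    by rewrite coprimep_expl // coprimep_expr // coprimep_XsubC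
      root_XsubC eq_sym.
  have [[u v] /= uv1] := Bezout_eq1_coprimepP _ _ cop.
  have hX l : horner_mx X (('X - l%:P) ^+ n.+1) = (X - l%:A) ^+ n.+1.
    by rewrite rmorphXn rmorphB /= horner_mx_X horner_mx_C scalemx1.
  rewrite -[LHS]mul1r -(rmorph1 (horner_mx X)) -uv1 rmorphD !rmorphM /= !hX.
  have z1 : (X - mu%:A) ^+ n.+1 * (E mu * E nu) = 0 by rewrite mulrA nilE mul0r.
  have z2 : (X - nu%:A) ^+ n.+1 * (E mu * E nu) = 0.
    by rewrite (commE _ _ (XE nu)).1 mulrA nilE mul0r.
  by rewrite mulrDl -!mulrA z1 z2 !mulr0 addr0.
have [rs char_rs] := closed_field_poly_normal (char_poly X).
move: char_rs; rewrite (monicP (char_poly_monic X)) scale1r => char_rs.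
have sumE s : uniq s -> forall mu,
  E mu * (\sum_(nu <- s) E nu) = if mu \in s then E mu else 0.
  elim: s => [|nu s IHs] /=; first by move=> _ mu; rewrite big_nil mulr0.
  move=> /andP[nus /IHs {}IHs] mu; rewrite big_cons mulrDr IHs inE.
  have [->|neq] := eqVneq mu nu; first by rewrite EE (negPf nus) addr0.
  by rewrite E0 // add0r.
exists (undup rs), E; split=> //; split; first exact: undup_uniq.
set S := \sum_(mu <- _) _; apply/eqP; rewrite eq_sym -subr_eq0; apply/eqP.
set Z := 1 - S.
have XS : GRing.comm X Z by apply/commrB; [apply: commr1 | apply: commr_sum].
(* Since [1 - E mu] is a multiple of [X - mu], each root, counted with multiplicity, splits one more
   factor off [Z]. So [Z] is a multiple of the characteristic polynomial at [X], hence 0. *)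
have ZE mu : mu \in rs -> (1 - E mu) * Z = Z.
  by move=> rs_mu; rewrite mulrBl mul1r mulrBr mulr1 sumE ?undup_uniq //
    mem_undup rs_mu subrr subr0.
have ZP s : {subset s <= rs} ->
    exists W, Z = horner_mx X (\prod_(mu <- s) ('X - mu%:P)) * W.
  elim: s => [|mu s IHs] s_rs; first by exists Z; rewrite big_nil rmorph1 mul1r.
  have [|W ZW] := IHs; first by move=> nu nus; apply: s_rs;
    rewrite inE nus orbT.
  exists (U mu * W); rewrite big_cons rmorphM rmorphB /= horner_mx_X
    horner_mx_C -scalemx1.
  rewrite -mulrA [horner_mx _ _ * _]mulrA.
  have -> : horner_mx X (\prod_(nu <- s) ('X - nu%:P)) * U mu
          = U mu * horner_mx X (\prod_(nu <- s) ('X - nu%:P)).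
    exact: comm_horner_mx (XU mu).
  by rewrite !mulrA -EC -mulrA -ZW ZE // s_rs ?mem_head.
have [W ->] := ZP rs (fun _ => id).
by rewrite -char_rs Cayley_Hamilton mul0r.
Qed.

Lemma primary_decomposition (F : closedFieldType) (V : vectType F)
    (phi : 'End(V)) v :
  exists (rs : seq F) (w : F -> V) (k : nat), v = \sum_(mu <- rs) w mu /\
    forall mu, iter k (fun u => phi u - mu *: u) (w mu) = 0.
Proof.
pose A := lin1_mx (v2r \o phi \o r2v).
have phiE u : v2r (phi u) = v2r u *m A by rewrite mul_rV_lin1 /= v2rK.
suff: exists (rs : seq F) (w : F -> 'rV[F]_(dim V)) (k : nat),
  v2r v = \sum_(mu <- rs) w mu /\
    forall mu, iter k (fun u => u *m A - mu *: u) (w mu) = 0.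
  move=> [rs [w [k [vw w0]]]]; exists rs, (r2v \o w), k; split.
    by rewrite -[v]v2rK vw linear_sum.
  move=> mu; apply: v2r_inj; rewrite linear0 -(w0 mu) /=.
  elim: k {w0} => [|k IHk] /=; first by rewrite r2vK.
  by rewrite linearB linearZ /= phiE IHk.
move: (v2r v) A {phiE} => u A; move: u A; case: (dim V) => [|n] u A.
  by exists [::], (fun=> 0), 0%N; split=> //; rewrite big_nil [u]thinmx0.
have [rs [E [[_ sumE] _ _ XE nilE]]] := spectral_idempotents A.
exists rs, (fun mu => u *m E mu), n.+1; split.
  by rewrite -mulmx_sumr sumE mulmx1.
move=> mu; have iterE k : iter k (fun u => u *m A - mu *: u) (u *m E mu)
   = u *m ((A - mu%:A) ^+ k * E mu).
  elim: k => [|k IHk]; first by rewrite expr0 mul1r.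
  rewrite iterS IHk exprS.
  have AB : GRing.comm A ((A - mu%:A) ^+ k * E mu).
    by apply/commrM => //; apply/commrX/commr_sym/comm_sub_scalar/commr_refl.
  rewrite -mulrA mulrBl AB -scalerAl mul1r mulmxBr -scalemxAr.
  by rewrite -[in LHS]mulmxA.
by rewrite iterE nilE mulmx0.
Qed.

(** A generalized [la]-eigenvector of ad [X] moves the generalized eigenspace of [X] at [mu] into
    the one at [mu + la]. *)
Lemma weight_shift (F : fieldType) n (X Y P Q : 'M[F]_n.+1) (la mu nu : F) k m :
  GRing.comm X P -> GRing.comm X Q ->
  (X - mu%:A) ^+ m * P = 0 -> (X - nu%:A) ^+ m * Q = 0 ->
  iter k (fun Z => Z * X - X * Z - la *: Z) Y = 0 -> nu - mu != la ->
  P * Y * Q = 0.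
Proof.
move=> XP XQ nilP nilQ; rewrite -subr_eq0; set c := nu - mu - la; move=> Y0 c0.
set T := fun Z => _ in Y0; set A := X - mu%:A in nilP;
  set B := X - nu%:A in nilQ.
have AP : GRing.comm A P by apply: comm_sub_scalar.
have BQ : GRing.comm B Q by apply: comm_sub_scalar.
(* c Z = Z' - Z (X - nu) + (X - mu) Z for Z' the image of Z under
   ad X - la: on P * Y * Q the nonzero scalar c is a sum of commuting
   nilpotent operators. *)
pose Z i p q := A ^+ p * P * iter i T Y * Q * B ^+ q.
have Zrec i p q : c *: Z i p q = Z i.+1 p q - Z i p q.+1 + Z i p.+1 q.
  have TE W : T W = W * B - A * W + c *: W.
    rewrite /T /A /B /c mulrBr mulrBl -scalerAl -scalerAr mul1r mulr1 !scalerBl.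
    have aux (V : zmodType) (x y z s t : V) :
        x - y - z = x - s - (y - t) + (s - t - z).
      rewrite opprB -!addrA; congr (_ + _).
      by rewrite (addrCA (- y) s) (addrCA t s) addKr (addrCA (- y)) addNKr.
    exact: aux.
  have AP' : A ^+ p.+1 * P = A ^+ p * P * A by rewrite exprSr -!mulrA AP.
  have BQ' : Q * B ^+ q.+1 = B * (Q * B ^+ q) by rewrite exprS !mulrA BQ.
  rewrite /Z iterS TE AP' -!(mulrA _ Q) BQ' mulrDr mulrBr mulrDl mulrBl !mulrA.
  rewrite -scalerAr -!scalerAl.
  have aux (V : zmodType) (x y z : V) : z = x - y + z - x + y.
    by rewrite (addrAC (x - y)) (addrAC x) subrr add0r addrAC addNr add0r.
  exact: aux.
(* Descending induction on [i + p + q]: once the sum reaches [k + m + m], one exponent is large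
   enough to kill the product, and [Zrec] carries the vanishing down to [Z 0 0 0 = P * Y * Q]. *)
have Z0 j : forall i p q, (k + m + m <= i + p + q + j)%N -> Z i p q = 0.
  elim: j => [|j IHj] i p q le_s.
    have [ki|ik] := leqP k i.
      rewrite /Z -(subnK ki) iterD Y0; have -> : iter (i - k) T 0 = 0.
        elim: (_ - _)%N => //= l ->.
        by rewrite /T mul0r mulr0 scaler0 !subr0.
      by rewrite mulr0 !mul0r.
    have [mp|pm] := leqP m p.
      by rewrite /Z -(subnK mp) exprD -(mulrA _ _ P) nilP mulr0 !mul0r.
    have [mq|qm] := leqP m q.
      rewrite /Z -mulrA; have -> : Q * B ^+ q = B ^+ q * Q
        by apply/commrX/commr_sym.
      by rewrite -(subnK mq) exprD -(mulrA _ _ Q) nilQ !mulr0.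
    have := leq_add (leq_add ik pm) qm.
    by rewrite !addSn !addnS ltnNge; lia.
  apply: (scalerI c0); rewrite Zrec scaler0 !IHj ?addr0 ?subr0 //; lia.
have := Z0 (k + m + m)%N 0%N 0%N 0%N.
by rewrite /Z !expr0 mul1r mulr1; apply; rewrite !add0n.
Qed.

(** * Cartan's criterion *)

Lemma mxtrace_commutator (F : fieldType) n (U V W : 'M[F]_n) :
  \tr ((U *m V - V *m U) *m W) = \tr (U *m (V *m W - W *m V)).
Proof.
rewrite mulmxBl mulmxBr !linearB /= -!mulmxA; congr (_ - _).
by rewrite [LHS]mxtrace_mulC mulmxA.
Qed.

(** For an alternating bracket the right Leibniz identity is the Jacobi identity. *)
Definition simple_lie (F : fieldType) (g : vectType F)
    (b : {bilinear g -> g -> g}) : Prop :=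
  [/\ right_leibniz b, forall x, b x x = 0, exists x y, b x y != 0 &
      forall J, ideal b J -> J = 0%VS \/ J = fullv].

(* Matrices act on row vectors from the right, whence the order of the
   factors. *)
Definition representation (F : fieldType) (g : vectType F)
    (b : {bilinear g -> g -> g}) n (rho : g -> 'M[F]_n) : Prop :=
  forall x y, rho (b x y) = rho x *m rho y - rho y *m rho x.

Section SimpleLie.

Variables (F : numClosedFieldType) (g : vectType F).
Variables (b : {bilinear g -> g -> g}) (simple_b : simple_lie b).

Lemma bracketC x y : b x y = - b y x.
Proof.
have [_ alt _ _] := simple_b; apply/eqP; rewrite -addr_eq0; apply/eqP.
by rewrite -(alt (x + y)) linearDl !linearD /= !alt add0r addr0.
Qed.

(** The derived algebra is a nonzero ideal, hence everything; scalars are absorbed into the left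
    factors. *)
Lemma bracket_sum x : exists s : seq (g * g), x = \sum_(p <- s) b p.1 p.2.
Proof.
have [leib alt [x0 [y0 b0]] simp] := simple_b.
have idD : ideal b (brv b fullv fullv).
  split; first exact: subvf.
  by move=> u v _ _; have /brv_leP sD := subvv (brv b fullv fullv); split;
    apply: sD; apply: memvf.
have /brv_leP memD := subvv (brv b fullv fullv).
have [D0|DT] := simp _ idD.
  by have := memD x0 y0 (memvf _) (memvf _); rewrite D0 memv0 (negPf b0).
have : x \in brv b fullv fullv by rewrite DT memvf.
pose s := [seq b u v | u <- vbasis (@fullv _ g), v <- vbasis (@fullv _ g)].
move=> /(@coord_span _ _ _ (in_tuple s)) ->.
elim/big_ind: _ => [|_ _ [s1 ->] [s2 ->]|i _].
- by exists [::]; rewrite big_nil.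
- by exists (s1 ++ s2); rewrite big_cat.
have /allpairsP[[u v] /= [_ _ ->]] : (in_tuple s)`_i \in s by apply: mem_nth;
  case: i.
by exists [:: (coord (in_tuple s) i x *: u, v)];
  rewrite big_seq1 /= linearZl_LR.
Qed.

Section Representation.

Variables (n : nat) (rho : {linear g -> 'M[F]_n.+1}).
Hypothesis rho_b : representation b rho.

Lemma trace_form_nilpotent x :
  (forall x y, \tr (rho x * rho y) = 0) -> rho x ^+ n.+1 = 0.
Proof.
move=> tr0; set X := rho x.
have [rs [E [[uniq_rs sumE] EE E0 XE nilE]]] := spectral_idempotents X.
pose S := \sum_(mu <- rs) mu^* *: E mu.
have SE mu : mu \in rs -> S * E mu = mu^* *: E mu.
  move=> rs_mu; rewrite mulr_suml (bigD1_seq mu) //= -scalerAl EE big1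
    ?addr0 //.
  by move=> nu neq; rewrite -scalerAl E0 ?scaler0.
have ES mu : mu \in rs -> E mu * S = mu^* *: E mu.
  move=> rs_mu; rewrite mulr_sumr (bigD1_seq mu) //= -scalerAr EE big1
    ?addr0 //.
  by move=> nu neq; rewrite -scalerAr E0 ?scaler0 // eq_sym.
have sandwich Y : Y = \sum_(mu <- rs) \sum_(nu <- rs) E mu * Y * E nu.
  rewrite -{1}[Y]mul1r -{1}[1 * Y]mulr1 -sumE mulr_suml mulr_suml.
  by apply: eq_bigr => mu _; rewrite mulr_sumr.
(* On a generalized [la]-eigenvector [w la] of ad [x], only the blocks with [nu - mu = la] survive,
   and there the commutator with [S] multiplies by [nu^* - mu^* = la^*]. So [y'] is [y] with each
   component [w la] scaled by [la^*]. *)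
have adS y : exists y', rho y * S - S * rho y = rho y'.
  have [rs' [w [k [-> w0]]]] := primary_decomposition (linfun (applyr b x)) y.
  exists (\sum_(la <- rs') la^* *: w la).
  rewrite !linear_sum mulr_suml mulr_sumr -sumrB; apply: eq_bigr => la _.
  rewrite linearZ /=; set Y := rho (w la).
  have Y0 : iter k (fun Z => Z * X - X * Z - la *: Z) Y = 0.
    rewrite -(linear0 rho) -(w0 la) /Y; elim: {w0} k => //= k ->.
    by rewrite [in RHS]linearB [in RHS]linearZ /= lfunE /= rho_b.
  rewrite [LHS]sandwich [in RHS](sandwich Y) scaler_sumr.
  apply: eq_big_seq => mu rs_mu; rewrite scaler_sumr;
    apply: eq_big_seq => nu rs_nu.
  have -> : E mu * (Y * S - S * Y) * E nu = (nu^* - mu^*) *: (E mu * Y * E nu).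
    rewrite mulrBr mulrBl !mulrA ES // -!mulrA SE //.
    by rewrite -scalerAl -!scalerAr -scalerBl.
  have [<-|neq] := eqVneq (nu - mu) la; first by rewrite rmorphB.
  by rewrite (weight_shift (XE mu) (XE nu) (nilE mu) (nilE nu) Y0 neq) !scaler0.
have trXS : \tr (X * S) = 0.
  rewrite /X; have [s ->] := bracket_sum x.
  rewrite linear_sum mulr_suml linear_sum /= big1_seq // => -[u v] /= _.
  have [v' v'E] := adS v.
  by rewrite rho_b mxtrace_commutator v'E tr0.
have trE mu : \tr (X * E mu) = mu * (\rank (E mu))%:R.
  rewrite -mxtrace_idempotent ?mulmxE ?EE // -linearZ /=.
  have -> : X * E mu = (X - mu%:A) * E mu + mu *: E mu.
    by rewrite mulrBl -scalerAl mul1r subrK.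
  rewrite linearD /= (@mxtrace_nilpotent _ _ _ n.+1) ?add0r //.
  rewrite exprMn_comm.
    have -> : E mu ^+ n.+1 = E mu.
      have EX m : E mu ^+ m.+1 = E mu by elim: m => // m IHm; rewrite exprS IHm.
      exact: EX.
    by rewrite nilE.
  exact: comm_sub_scalar.
have rank0 mu : mu \in rs -> mu != 0 -> E mu = 0.
  move=> rs_mu mu0; apply/eqP; rewrite -mxrank_eq0.
  have: \sum_(mu <- rs) `|mu| ^+ 2 * (\rank (E mu))%:R == 0.
    rewrite -[X in _ == X]trXS mulr_sumr linear_sum; apply/eqP/eq_bigr => nu _.
    by rewrite -scalerAr linearZ /= trE normCK mulrA [nu * _]mulrC.
  rewrite psumr_eq0 => [/allP/(_ mu rs_mu)/=|nu _].
    by rewrite mulf_eq0 sqrf_eq0 normr_eq0 (negPf mu0) pnatr_eq0.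
  by rewrite mulr_ge0 ?ler0n // exprn_ge0.
rewrite -[LHS]mulr1 -sumE mulr_sumr big1_seq // => mu /= rs_mu.
have [mu0|/rank0->] := eqVneq mu 0; rewrite ?mulr0 //.
by rewrite -(nilE mu) mu0 scale0r subr0.
Qed.

End Representation.
End SimpleLie.

(** * Engel's theorem and nondegeneracy of the trace form *)

(** A subspace of maximal dimension inside [P] exhausts it: a missing vector could be adjoined. *)
Lemma vspace_of_linear (F : fieldType) (V : vectType F) (P : V -> Prop) :
  P 0 -> (forall a x y, P x -> P y -> P (a *: x + y)) ->
  exists U : {vspace V}, forall x, x \in U <-> P x.
Proof.
move=> P0 PD; pose Q d :=
  `[< exists2 U : {vspace V}, \dim U = d & forall x, x \in U -> P x >].
have Q0 : exists d, Q d.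
  by exists 0%N; apply/asboolP; exists 0%VS; rewrite ?dimv0 // => x;
    rewrite memv0 => /eqP->.
have Qmax d : Q d -> (d <= \dim (@fullv _ V))%N.
  by move=> /asboolP[U <- _]; apply/dimvS/subvf.
case: (ex_maxnP Q0 Qmax) => d /asboolP[U dU UP] maxU.
exists U => x; split=> [/UP //|Px]; apply: contraPT (leqnn d) => xU.
have /maxU : Q (\dim (U + <[x]>)).
  apply/asboolP; exists (U + <[x]>)%VS => //
    _ /memv_addP[u /UP Pu [_ /vlineP[a ->] ->]].
  by rewrite addrC; apply: PD.
rewrite -{1}dU; suff: (\dim U < \dim (U + <[x]>))%N by rewrite dU; lia.
rewrite (ltn_leqif (dimv_leqif_sup (addvSl U <[x]>))).
by apply: contra xU => /subvP/(_ x)->//; rewrite memvE addvSr.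
Qed.

Section Engel.

Variables (F : numClosedFieldType) (g : vectType F).
Variables (b : {bilinear g -> g -> g}) (simple_b : simple_lie b).

Definition subalgebra (K : {vspace g}) :=
  forall x y, x \in K -> y \in K -> b x y \in K.

Hypothesis ad_nilp : forall x, exists k, forall y, iter k (b^~ x) y = 0.

(* Engel's theorem for ad K acting on the quotient U / M. *)
Definition engel_upto n := forall K M U : {vspace g},
  (\dim K <= n)%N -> subalgebra K -> ~~ (U <= M)%VS ->
  (forall m k, m \in M -> k \in K -> b m k \in M) ->
  (forall u k, u \in U -> k \in K -> b u k \in U) ->
  exists v, [/\ v \in U, v \notin M & forall k, k \in K -> b v k \in M].

(** A proper subalgebra [H] of [K], starting from 0, is enlarged step by step: Engel for [H] acting
    on [K / H] gives [x] outside [H] that normalizes [H], so [H + <[x]>] is a subalgebra. The last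
    step before reaching [K] gives the claim. *)
Lemma engel_codim1 n (K : {vspace g}) : engel_upto n ->
  (\dim K <= n.+1)%N -> K != 0%VS -> subalgebra K ->
  exists (H : {vspace g}) x, [/\ subalgebra H, x \notin H,
    forall h, h \in H -> b x h \in H & K = (H + <[x]>)%VS].
Proof.
have [_ alt _ _] := simple_b.
move=> engel dK K0 subK.
suff claim j : forall H : {vspace g}, (\dim K - \dim H <= j)%N ->
    (H <= K)%VS -> ~~ (K <= H)%VS -> subalgebra H ->
    exists (H : {vspace g}) x, [/\ subalgebra H, x \notin H,
      forall h, h \in H -> b x h \in H & K = (H + <[x]>)%VS].
  apply: (claim _ 0%VS (leqnn _)); rewrite ?sub0v ?subv0 // => x y.
  by rewrite !memv0 => /eqP-> _; rewrite linear0l.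
elim: j => [|j IHj] H dH HK KH subH; have ltHK : (\dim H < \dim K)%N
  by rewrite (ltn_leqif (dimv_leqif_sup HK)).
  by lia.
have [||x [xK xH Hx]] := engel H H K _ subH KH subH; first by lia.
  by move=> u k uK /(subvP HK); apply: subK.
have HxK : (H + <[x]> <= K)%VS by rewrite subv_add HK -memvE.
have [KHx|KHx] := boolP (K <= H + <[x]>)%VS.
  by exists H, x; split=> //; apply/eqP; rewrite eqEsubv KHx.
have ltH : (\dim H < \dim (H + <[x]>))%N.
  rewrite (ltn_leqif (dimv_leqif_sup (addvSl _ _))).
  by apply: contra xH => /subvP/(_ x)->//; rewrite memvE addvSr.
apply: (IHj _ _ HxK KHx); first by lia.
move=> _ _ /memv_addP[h hH [_ /vlineP[a ->] ->]] /memv_addP[h' hH'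
  [_ /vlineP[a' ->] ->]].
apply: (subvP (addvSl H <[x]>)).
rewrite linearDl !linearD /= !linearZl_LR !linearZr_LR /= alt !scaler0 addr0.
rewrite (bracketC simple_b h x) scalerN.
by rewrite !rpredD ?rpredN ?rpredZ //; [apply: subH | apply: Hx | apply: Hx].
Qed.

(** Write [K = H + <[x]>] and take [w] outside [M] that [H] sends into [M]. As [x] normalizes [H],
    all iterates of [w] under ad [x] keep this property; the last one outside [M] is sent into [M]
    by [x] as well. *)
Lemma engel n : engel_upto n.
Proof.
have [leib _ _ _] := simple_b.
elim: n => [|n IHn] K M U dK subK UM MK UK.
  have [v vU vM] := subvPn UM; exists v; split=> // k.
  by move: dK; rewrite leqn0 dimv_eq0 => /eqP->; rewrite memv0 => /eqP->;
    rewrite linear0 mem0v.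
have [K0|K0] := eqVneq K 0%VS.
  have [v vU vM] := subvPn UM; exists v; split=> // k.
  by rewrite K0 memv0 => /eqP->; rewrite linear0 mem0v.
have [H [x [subH xH Hx KE]]] := engel_codim1 IHn dK K0 subK.
have HK : (H <= K)%VS by rewrite KE addvSl.
have xK : x \in K by rewrite memvE KE addvSr.
have dH : (\dim H <= n)%N.
  rewrite -ltnS; apply: leq_trans dK; rewrite (ltn_leqif (dimv_leqif_sup HK)).
  by apply: contra xH => /subvP/(_ x xK).
have [||w [wU wM wH]] := IHn H M U dH subH UM.
- by move=> m k mM /(subvP HK); apply: MK.
- by move=> u k uU /(subvP HK); apply: UK.
pose w_ i := iter i (b^~ x) w.
have w_U i : w_ i \in U /\ forall h, h \in H -> b (w_ i) h \in M.
  elim: i => [|i [wiU wiH]] //; split=> [|h hH]; first exact: UK.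
  have -> : b (w_ i.+1) h = b (w_ i) (b x h) + b (b (w_ i) h) x
    by rewrite leib subrK.
  by apply: rpredD; [apply/wiH/Hx | apply: MK => //; apply: wiH].
have ex_i : exists i, w_ i \in M.
  by have [k k0] := ad_nilp x; exists k; rewrite /w_ k0 mem0v.
case: (ex_minnP ex_i) => -[|i] wiM min_i; first by case/negP: wM.
have [wiU wiH] := w_U i; exists (w_ i); split=> //.
  by apply: contraT => /negPn /min_i; rewrite ltnn.
rewrite KE => _ /memv_addP[h hH [_ /vlineP[a ->] ->]].
by rewrite linearD /= linearZr_LR rpredD ?rpredZ // wiH.
Qed.

(** The codimension 1 subalgebra that [x] normalizes is an ideal, hence 0; then the algebra is a
    line and its bracket vanishes. *)
Lemma simple_not_ad_nilpotent : False.
Proof.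
have [_ alt [x0 [y0 b0]] simp] := simple_b.
have full0 : @fullv _ g != 0%VS.
  apply: contraNneq b0 => g0; have := memvf x0; rewrite g0 memv0 => /eqP->.
  by rewrite linear0l.
have [H [x [subH xH Hx gE]]] :=
  engel_codim1 (@engel _) (leqnSn _) full0 (fun x y _ _ => memvf (b x y)).
have idH : ideal b H.
  split=> [|y h]; first exact: subvf.
  rewrite gE => /memv_addP[h' hH' [_ /vlineP[a ->] ->]] hH.
  have yh : b (h' + a *: x) h \in H.
    by rewrite linearDl linearZl_LR rpredD ?rpredZ ?Hx // subH.
  by rewrite (bracketC simple_b h) rpredN.
have [H0|HT] := simp _ idH; last by rewrite HT memvf in xH.
case/eqP: b0; move: (memvf x0) (memvf y0).
rewrite gE H0 add0v => /vlineP[a ->] /vlineP[a' ->].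
by rewrite linearZl_LR linearZr_LR /= alt !scaler0.
Qed.

End Engel.

(** * Nondegeneracy of the trace form of a nonzero representation *)

Section Nondegenerate.

Variables (F : numClosedFieldType) (g : vectType F).
Variables (b : {bilinear g -> g -> g}) (simple_b : simple_lie b).
Variables (n : nat) (rho : {linear g -> 'M[F]_n.+1}).
Hypothesis rho_b : representation b rho.

(** The kernel of [rho] and the radical [Z] of the trace form are ideals, so [rho] is faithful and
    [Z] is 0 or everything. In the latter case every [rho u] is nilpotent, hence so is every ad
    [u]. *)
Lemma trace_form_nondegenerate x :
  (exists y, rho y != 0) -> (forall y, \tr (rho x * rho y) = 0) -> x = 0.
Proof.
move=> [y0 rho0] trx; have [_ alt _ simp] := simple_b.
have [N NP] : exists N : {vspace g}, forall x, x \in N <-> rho x = 0.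
  apply: vspace_of_linear => [|a u v u0 v0]; first by rewrite linear0.
  by rewrite linearP u0 v0 scaler0 addr0.
have idN : ideal b N.
  split=> [|u v _ /NP v0]; first exact: subvf.
  by split; apply/NP; rewrite rho_b v0 mulmx0 mul0mx subrr.
have rho_inj u : rho u = 0 -> u = 0.
  have [N0|NT] := simp _ idN; first by move/NP; rewrite N0 memv0 => /eqP.
  by case/eqP: rho0; apply/NP; rewrite NT memvf.
have [Z ZP] : exists Z : {vspace g},
    forall x, x \in Z <-> forall y, \tr (rho x * rho y) = 0.
  apply: vspace_of_linear => [y|a u v u0 v0 y];
    first by rewrite linear0 mul0r linear0.
  by rewrite linearP mulrDl -scalerAl linearD linearZ /= u0 v0 mulr0 addr0.
have idZ : ideal b Z.
  split=> [|u v _ /ZP v0]; first exact: subvf.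
  have vu : b v u \in Z.
    by apply/ZP => y; rewrite rho_b mxtrace_commutator -rho_b v0.
  by split=> //; rewrite (bracketC simple_b) rpredN.
have [Z0|ZT] := simp _ idZ; first by have /ZP := trx; rewrite Z0 memv0 => /eqP.
case: (simple_not_ad_nilpotent simple_b) => u.
have nilp : rho u ^+ n.+1 = 0.
  apply: (trace_form_nilpotent simple_b rho_b) => v w.
  by have /ZP-> : v \in Z by rewrite ZT memvf.
exists (n.+1 + n.+1)%N => v; apply: rho_inj.
(* Each bracket with [u] puts one more factor [rho u] on the left or on the right; after [2 (n + 1)]
   of them one side carries a vanishing power. *)
have iterE j : forall p q, (n.+1 + n.+1 <= j + p + q)%N ->
    rho u ^+ p * rho (iter j (b^~ u) v) * rho u ^+ q = 0.
  elim: j => [|j IHj] p q le_pq /=.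
    have [np|pn] := leqP n.+1 p;
      first by rewrite -(subnK np) exprD nilp mulr0 !mul0r.
    have nq : (n.+1 <= q)%N by lia.
    by rewrite -(subnK nq) exprD nilp !mulr0.
  rewrite rho_b !mulmxE mulrBr mulrBl -!mulrA -exprS !mulrA -exprSr.
  by rewrite !IHj ?subrr //; lia.
by have := iterE (n.+1 + n.+1)%N 0%N 0%N; rewrite !expr0 mulr1 mul1r !addn0;
  apply.
Qed.

End Nondegenerate.

(** * Whitehead's first lemma *)

Section Whitehead.

Variables (F : numClosedFieldType) (g : vectType F).
Variables (b : {bilinear g -> g -> g}) (simple_b : simple_lie b).

Lemma trace_form_dual_basis n (rho : {linear g -> 'M[F]_n.+1}) :
  representation b rho -> (exists y, rho y != 0) ->
  exists e e' : 'I_(\dim (@fullv _ g)) -> g,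
    [/\ forall z, z = \sum_i \tr (rho z * rho (e' i)) *: e i,
        forall z, z = \sum_i \tr (rho z * rho (e i)) *: e' i &
        forall i, \tr (rho (e i) * rho (e' i)) = 1].
Proof.
move=> rho_b rho0; pose B x y := \tr (rho x * rho y).
have BC x y : B x y = B y x by rewrite /B mxtrace_mulC.
have BD I (r : seq I) (c : I -> F) (u : I -> g) y :
    B (\sum_(i <- r) c i *: u i) y = \sum_(i <- r) c i * B (u i) y.
  rewrite /B linear_sum mulr_suml linear_sum; apply: eq_bigr => i _.
  by rewrite linearZ /= -scalerAl linearZ.
have B_nondeg x : (forall y, B x y = 0) -> x = 0.
  exact: (trace_form_nondegenerate simple_b rho_b rho0).
pose e (i : 'I_(\dim (@fullv _ g))) := (vbasis (@fullv _ g))`_i.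
have eP z : z = \sum_i coord (vbasis fullv) i z *: e i
  by apply/coord_vbasis/memvf.
pose Gram := \matrix_(i, j) B (e i) (e j).
have Gram_u : Gram \in unitmx.
  rewrite -row_free_unit -kermx_eq0; apply/eqP/row_matrixP => i; rewrite row0.
  have : row i (kermx Gram) *m Gram = 0 by rewrite -row_mul mulmx_ker row0.
  move: (row i _) => u uG.
  have z0 : \sum_j u 0 j *: e j = 0.
    apply: B_nondeg => y; rewrite (eP y) BC BD big1 // => k _.
    rewrite BC BD; apply/eqP; rewrite mulf_eq0; apply/orP; right; apply/eqP.
    transitivity ((u *m Gram) 0 k); last by rewrite uG mxE.
    by rewrite mxE; apply: eq_bigr => j _; rewrite [Gram _ _]mxE.
  apply/rowP => j; rewrite mxE.
  exact: (freeP (basis_free (vbasisP (@fullv _ g))) (u 0) z0 j).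
(* The columns of the inverse Gram matrix give the basis dual to [e] for the trace form. *)
pose e' j := \sum_k invmx Gram k j *: e k.
have Bee' i j : B (e i) (e' j) = (i == j)%:R.
  transitivity ((Gram *m invmx Gram) i j); last by rewrite mulmxV // mxE.
  rewrite mxE BC BD; apply: eq_bigr => k _; by rewrite mulrC BC mxE.
exists e, e'; split=> [z|z|i]; last by rewrite -/(B _ _) Bee' eqxx.
  rewrite {1}(eP z); apply: eq_bigr => i _; congr (_ *: _).
  rewrite -/(B _ _) {2}(eP z) BD (bigD1 i) //= Bee' eqxx mulr1 big1 ?addr0 //
    => j ji.
  by rewrite Bee' (negPf ji) mulr0.
apply/eqP; rewrite -subr_eq0; apply/eqP/B_nondeg => y.
rewrite (eP y) BC BD big1 // => j _; apply/eqP; rewrite mulf_eq0; apply/orP;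
  right.
rewrite BC /B linearB mulrBl linearB /= -!/(B _ _) BD (bigD1 j) //=
  [X in X * _]BC.
rewrite [B (e' j) _]BC Bee' eqxx mulr1 big1 ?addr0 => [|i ij].
  by rewrite BC subrr.
by rewrite [B (e' i) _]BC Bee' eq_sym (negPf ij) mulr0.
Qed.

Definition cocycle n (rho : g -> 'M[F]_n) (f : g -> 'rV[F]_n) : Prop :=
  forall x y, f (b x y) = f x *m rho y - f y *m rho x.

(** The trace of [C] is the dimension of [g]. The clauses on [P] let [C] respect a projection that
    absorbs the action, as the induction in Whitehead's lemma requires. *)
Lemma casimir n (rho : {linear g -> 'M[F]_n.+1}) :
  representation b rho -> (exists y, rho y != 0) ->
  exists C : 'M[F]_n.+1,
    [/\ forall x, GRing.comm C (rho x), \tr C != 0,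
        forall P, (forall x, rho x * P = rho x) -> C * P = C,
        forall P, (forall x, P * rho x = rho x) -> P * C = C &
        forall f : {linear g -> 'rV[F]_n.+1}, cocycle rho f ->
          exists w, forall x, f x *m C = w *m rho x].
Proof.
move=> rho_b rho0.
have [e [e' [eP e'P ee']]] := trace_form_dual_basis rho_b rho0.
pose C := \sum_i rho (e i) * rho (e' i).
(* This is the invariance of the tensor [\sum_i e i (x) e' i] under ad [x]. With [f := rho] it makes
   [C] central; with [f] a cocycle it makes [f C] a coboundary. *)
have inv m (f : {linear g -> 'M[F]_(m, n.+1)}) x :
  \sum_i (f (b (e i) x) *m rho (e' i) + f (e i) *m rho (b (e' i) x)) = 0.
  rewrite big_split /=.
  under eq_bigr => i _ do rewrite (eP (b (e i) x)) linear_sum mulmx_suml /=.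
  under [X in _ + X]eq_bigr => j _ do
    rewrite (e'P (b (e' j) x)) linear_sum mulmx_sumr /=.
  rewrite [X in _ + X]exchange_big -big_split big1 //= => i _.
  rewrite -big_split big1 //= => j _.
  rewrite [f (_ *: _)]linearZ [rho (_ *: _)]linearZ /= -scalemxAl -scalemxAr
    -scalerDl.
  suff -> : \tr (rho (b (e i) x) * rho (e' j))
    = - \tr (rho (b (e' j) x) * rho (e i)).
    by rewrite addNr scale0r.
  rewrite [X in X * rho (e' j)]rho_b mxtrace_commutator -rho_b
    (bracketC simple_b x).
  by rewrite linearN mulmxN linearN /= mxtrace_mulC.
have rhoC x y : rho x *m rho y = rho y *m rho x + rho (b x y)
  by rewrite rho_b addrC subrK.
exists C; split.
- move=> x; rewrite /GRing.comm mulr_suml mulr_sumr.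
  transitivity (\sum_i (rho x * (rho (e i) * rho (e' i)) +
      (rho (b (e i) x) *m rho (e' i) + rho (e i) *m rho (b (e' i) x))));
        last first.
    by rewrite big_split /= (inv _ rho x) addr0.
  apply: eq_bigr => i _ /=.
  rewrite -!mulmxE -mulmxA rhoC mulmxDr mulmxA rhoC mulmxDl addrA.
  by rewrite -mulmxA.
- rewrite linear_sum /= (eq_bigr _ (fun i _ => ee' i)).
  rewrite sumr_const card_ord pnatr_eq0.
  rewrite -lt0n lt0n dimv_eq0; apply/eqP => g0; have [y /eqP[]] := rho0.
  by have := memvf y; rewrite g0 memv0 => /eqP->; rewrite linear0.
- by move=> P rhoP; rewrite mulr_suml; apply: eq_bigr => i _;
  rewrite -mulrA rhoP.
- by move=> P rhoP; rewrite mulr_sumr; apply: eq_bigr => i _;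
  rewrite mulrA rhoP.
move=> f f_b; exists (\sum_i f (e i) *m rho (e' i)) => x.
rewrite mulmx_suml mulmx_sumr.
transitivity (\sum_i (f x *m (rho (e i) * rho (e' i)) +
    (f (b (e i) x) *m rho (e' i) + f (e i) *m rho (b (e' i) x)))).
  by rewrite big_split /= (inv _ f x) addr0.
apply: eq_bigr => i _ /=.
rewrite -mulmxE -[in RHS]mulmxA (rhoC (e' i) x) mulmxDr f_b mulmxBl !mulmxA
  addrA.
by rewrite (addrC (f x *m _ *m _)) subrK.
Qed.

Lemma whitehead_mx n (rho : {linear g -> 'M[F]_n})
    (f : {linear g -> 'rV[F]_n}) :
  representation b rho -> cocycle rho f -> exists w, forall x, f x = w *m rho x.
Proof.
case: n rho f => [|n] rho f rho_b f_b.
  by exists 0 => x; rewrite [LHS]thinmx0 [RHS]thinmx0.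
(* P projects onto the Fitting components that remain to be treated, the
   action being zero on the others. *)
suff claim k : forall (rho : {linear g -> 'M[F]_n.+1})
    (f : {linear g -> 'rV[F]_n.+1}) (P : 'M_n.+1),
    (\rank P <= k)%N -> P * P = P ->
    (forall x, P * rho x = rho x) -> (forall x, rho x * P = rho x) ->
    representation b rho -> cocycle rho f ->
    exists w, forall x, f x = w *m rho x.
  apply: (claim n.+1 rho f 1) => // [|||x];
    rewrite ?rank_leq_row ?mulr1 // => x.
  by rewrite mul1r.
elim: k => [|k IHk] {}rho {}f P rkP PP Prho rhoP {}rho_b {}f_b.
  exists 0 => x; rewrite mul0mx; have rho0 y : rho y = 0.
    by move: rkP; rewrite leqn0 mxrank_eq0 -Prho => /eqP->; rewrite mul0r.
  have [s ->] := bracket_sum simple_b x; rewrite linear_sum big1 // => p _ /=.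
  by rewrite f_b !rho0 !mulmx0 subrr.
have [rho0|rho0] := pselect (exists y, rho y != 0); last first.
  have {}rho0 y : rho y = 0 by apply: contra_notP rho0 => /eqP; exists y.
  exists 0 => x; rewrite mul0mx.
  have [s ->] := bracket_sum simple_b x; rewrite linear_sum big1 // => p _ /=.
  by rewrite f_b !rho0 !mulmx0 subrr.
have [C [Crho trC CP PC C_f]] := casimir rho_b rho0.
have {C_f} [w0 w0P] := C_f f f_b.
have [[E U] /= [EE nilE EC commE]] := fitting_idempotent C.
have Erho x : rho x * E = E * rho x by have [->] := commE _ (Crho x).
have [EP _] : GRing.comm E P /\ GRing.comm U P.
  by apply: commE; rewrite /GRing.comm CP ?PC.
(* The rank of [P] is that of [P E] plus that of [1 - E], by traces of idempotents. If [1 - E] were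
   0, [C] would be nilpotent, against its nonzero trace. *)
have rkPE : (\rank (P * E)%R <= k)%N.
  rewrite -ltnS; apply: leq_trans rkP.
  have PEPE : P * E *m (P * E) = P * E
    by rewrite mulmxE -mulrA (mulrA E) EP -mulrA EE mulrA PP.
  have E1 : P * (1 - E) = 1 - E by rewrite EC mulrA PC.
  have E1E1 : (1 - E) *m (1 - E) = 1 - E.
    by rewrite mulmxE mulrBr mulr1 mulrBl mul1r EE subrr subr0.
  have := mxtrace_idempotent PP;
    rewrite -{1}[P]mulr1 -{1}[1](subrK E) mulrDr E1.
  rewrite linearD /= mxtrace_idempotent // mxtrace_idempotent // -natrD => /eqP.
  rewrite eqr_nat => /eqP <-;
    rewrite -[X in (X < _)%N]add0n ltn_add2r lt0n mxrank_eq0.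
  apply: contra trC; rewrite subr_eq0 => /eqP E1'.
  by rewrite (@mxtrace_nilpotent _ _ _ n.+1) // -nilE -E1' mulr1.
pose rhoE : {linear g -> 'M[F]_n.+1} := mulmxr E \o rho.
pose fE : {linear g -> 'rV[F]_n.+1} := mulmxr E \o f.
have [||x|x|x y|x y|w1 w1P] := IHk rhoE fE (P * E).
- by [].
- by rewrite -mulrA (mulrA E) EP -mulrA EE mulrA PP.
- by rewrite /= !mulmxE -mulrA (mulrA E) -Erho -mulrA EE mulrA Prho.
- by rewrite /= !mulmxE -mulrA (mulrA E) EP -mulrA EE mulrA rhoP.
- rewrite /= rho_b mulmxBl !mulmxE -!mulrA; congr (_ * _ - _ * _).
    by rewrite mulrA -Erho -mulrA EE.
  by rewrite mulrA -Erho -mulrA EE.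
- rewrite /fE /rhoE /= f_b mulmxBl -!mulmxA; congr (_ - _); congr (_ *m _).
    by rewrite !mulmxE mulrA -Erho -mulrA EE.
  by rewrite !mulmxE mulrA -Erho -mulrA EE.
(* Split [f x] along [1 = C U + E]: the first part is [w0 *m rho x *m U], the second comes from the
   induction hypothesis, and [U] and [E] commute with the action. *)
exists (w0 *m U + w1 *m E) => x.
rewrite -[LHS]mulmx1 -[1%:M](subrK E) mulmxDr EC -mulmxE mulmxA w0P mulmxDl.
rewrite -!mulmxA; congr (w0 *m _ + _).
  by rewrite mulmxE; have [_ ->] := commE _ (Crho x).
by have := w1P x; rewrite /= => ->; rewrite mulmxE Erho.
Qed.

(** Whitehead's lemma for the submodule that is the image of [Pi]; composing the action with [Pi]
    avoids a separate type for that submodule. *)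
Lemma whitehead (V : vectType F) (act : g -> V -> V)
    (Pi : 'End(V)) (f : g -> V) :
  (forall x, linear (act x)) -> (forall v, linear (act^~ v)) -> linear f ->
  (forall x y v, act (b x y) v = act y (act x v) - act x (act y v)) ->
  (forall v, Pi (Pi v) = Pi v) ->
  (forall x v, Pi (act x (Pi v)) = act x (Pi v)) ->
  (forall x, Pi (f x) = f x) ->
  (forall x y, f (b x y) = act y (f x) - act x (f y)) ->
  exists w, Pi w = w /\ forall x, f x = act x w.
Proof.
move=> act_lin act_lin' f_lin act_b PiPi Piact Pif f_b.
pose actL x : {linear V -> V} :=
  HB.pack (act x) (GRing.isLinear.Build F V V *:%R (act x) (act_lin x)).
pose A x : 'M[F]_(dim V) := lin1_mx (v2r \o actL x \o Pi \o r2v).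
have AE x u : u *m A x = v2r (act x (Pi (r2v u))) by rewrite mul_rV_lin1.
have A_lin : linear A.
  move=> a x y; apply/row_matrixP => i.
  by rewrite !rowE AE act_lin' linearP mulmxDr -scalemxAr !AE.
pose fr x := v2r (f x).
have fr_lin : linear fr by move=> a x y; rewrite /fr f_lin linearP.
pose rho : {linear g -> 'M[F]_(dim V)} :=
  HB.pack A (GRing.isLinear.Build F g _ *:%R A A_lin).
pose frho : {linear g -> 'rV[F]_(dim V)} :=
  HB.pack fr (GRing.isLinear.Build F g _ *:%R fr fr_lin).
have [||w wP] := @whitehead_mx _ rho frho.
- move=> x y; apply/row_matrixP => i; rewrite !rowE mulmxBr !mulmxA !AE !v2rK.
  by rewrite act_b !Piact linearB.
- by move=> x y; rewrite !AE /= /fr !v2rK !Pif f_b linearB.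
exists (Pi (r2v w)); split=> [|x]; first by rewrite PiPi.
by apply: v2r_inj; rewrite -AE -wP.
Qed.

End Whitehead.

(** * Modules over a simple subalgebra of a Leibniz algebra *)

(** A derivation is a cocycle with values in the adjoint module. *)
Lemma inner_derivation (F : numClosedFieldType) (g : vectType F)
    (b : {bilinear g -> g -> g}) (D : g -> g) : simple_lie b -> linear D ->
  (forall x y, D (b x y) = b (D x) y + b x (D y)) ->
  exists a, forall x, D x = b x a.
Proof.
move=> simple_b D_lin D_b; have [leib _ _ _] := simple_b.
have [||||||||w [_ wP]] := @whitehead _ _ _ simple_b g
  (fun x v => b v x) \1%VF D.
- by move=> x a u v; rewrite linearPl.
- by move=> v a x y; rewrite linearPr.
- by [].
- by move=> x y v; rewrite leib.
- by move=> v; rewrite !id_lfunE.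
- by move=> x v; rewrite !id_lfunE.
- by move=> x; rewrite id_lfunE.
- by move=> x y; rewrite D_b (bracketC simple_b x).
by exists (- w) => x; rewrite wP linearN /= (bracketC simple_b w).
Qed.

(** * The subspace [G] as a Lie algebra in its own right *)

Section SubBracket.

Variables (F : fieldType) (L : vectType F).
Variables (br : {bilinear L -> L -> L}) (G : {vspace L}).

(** [vsproj] only makes the value typecheck; it changes nothing when [G] is closed under the
    bracket. *)
Definition sub_bracket (x y : subvs_of G) : subvs_of G :=
  vsproj G (br (vsval x) (vsval y)).

Lemma sub_bracket_bilinear :
  bilinear_for (GRing.Scale.Law.clone _ _ *:%R _)
    (GRing.Scale.Law.clone _ _ *:%R _) sub_bracket.
Proof.
split=> u a x y; rewrite /sub_bracket linearP.
  by rewrite linearPl linearP.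
by rewrite !linearP.
Qed.

HB.instance Definition _ :=
  bilinear_isBilinear.Build F (subvs_of G) (subvs_of G) (subvs_of G) *:%R *:%R
    sub_bracket sub_bracket_bilinear.

End SubBracket.

Lemma lfunBE (F : fieldType) (U V : vectType F) (f h : 'Hom(U, V)) v :
  (f - h) v = f v - h v.
Proof. by rewrite add_lfunE opp_lfunE. Qed.

Section LeibnizModules.

Variables (F : numClosedFieldType) (L : vectType F).
Variables (br : {bilinear L -> L -> L}).
Variable (G : {vspace L}).
Hypotheses (leib : right_leibniz br) (simpleG : simple_lie_subalgebra br G).

Lemma val_sub_bracket x y :
  vsval (sub_bracket br x y : subvs_of G) = br (vsval x) (vsval y).
Proof.
have [[closedG _ _] _ _] := simpleG.
by rewrite /sub_bracket vsprojK // closedG ?subvsP.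
Qed.

Lemma sub_bracket_simple : simple_lie (@sub_bracket F L br G).
Proof.
have [[closedG alt _] [x0 [y0 [x0G y0G b0]]] simp] := simpleG.
split=> [x y z|x||J [_ idJ]].
- by apply: (can_inj vsvalK); rewrite linearB /= !val_sub_bracket leib.
- by apply: (can_inj vsvalK); rewrite linear0 val_sub_bracket alt ?subvsP.
- exists (vsproj G x0), (vsproj G y0); apply: contraNneq b0 => /(congr1 vsval).
  by rewrite val_sub_bracket !vsprojK // => ->.
pose J' := (linfun (vsval : subvs_of G -> L) @: J)%VS.
have memJ x : (vsval x \in J') = (x \in J).
  apply/memv_imgP/idP => [[y yJ]|xJ]; last by exists x; rewrite ?lfunE.
  by rewrite lfunE /= => /val_inj->.
have J'G : (J' <= G)%VS by apply/subvP => _ /memv_imgP[x _ ->];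
  rewrite lfunE subvsP.
have [|J0|JG] := simp J'.
- split=> // x y xG yJ; have yG := subvP J'G _ yJ.
  rewrite -(vsprojK xG) -(vsprojK yG) -!val_sub_bracket !memJ.
  by apply: idJ; rewrite ?memvf // -memJ vsprojK.
- left; apply/vspaceP => x; rewrite -memJ J0 !memv0.
  by rewrite -(can_eq vsvalK) linear0.
right; apply/vspaceP => x; by rewrite -memJ JG subvsP memvf.
Qed.

(** The commutators [[R_x, p]] of a linear projection [p] onto [N] form a cocycle with values in the
    maps [L -> N] that vanish on [N]. If it is the coboundary of such a map [w], then [p - w] is an
    equivariant projection onto [N], and its kernel in [M] is the complement. *)
Lemma submodule_complement (M N : {vspace L}) :
  right_submodule br G M -> right_submodule br G N -> (N <= M)%VS ->
  exists N', [/\ right_submodule br G N',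
    (N + N')%VS = M & (N :&: N')%VS = 0%VS].
Proof.
move=> subM subN NM; pose p := projv N.
have pN v : p v \in N by apply: memv_proj.
have pid v : v \in N -> p v = v by apply: projv_id.
pose R x : 'End(L) := linfun (applyr br x).
have RE x v : R x v = br v x by rewrite lfunE.
pose act (x : subvs_of G) (phi : 'End(L)) : 'End(L) :=
  (R (vsval x) \o phi)%VF - (phi \o R (vsval x))%VF.
have actE x phi v : act x phi v = br (phi v) (vsval x) - phi (br v (vsval x)).
  by rewrite /act lfunBE !comp_lfunE !RE.
clearbody act.
(* The projection of ['End(L)] onto the maps with values in [N] that vanish on [N]. *)
pose Pi0 (phi : 'End(L)) : 'End(L) := (p \o phi \o (\1%VF - p)%R)%VF.
have Pi0E phi v : Pi0 phi v = p (phi (v - p v)).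
  by rewrite /Pi0 !comp_lfunE lfunBE id_lfunE.
have Pi0_lin : linear Pi0.
  move=> a phi psi; apply/lfunP => v.
  by rewrite add_lfunE scale_lfunE !Pi0E add_lfunE scale_lfunE linearP.
pose Pi0L : {linear 'End(L) -> 'End(L)} :=
  HB.pack Pi0 (GRing.isLinear.Build F _ _ *:%R Pi0 Pi0_lin).
pose Pi := linfun Pi0L.
have PiE phi v : Pi phi v = p (phi (v - p v)) by rewrite lfunE Pi0E.
have Pi_fix (phi : 'End(L)) :
    (forall v, phi v \in N) -> (forall v, v \in N -> phi v = 0) ->
    Pi phi = phi.
  by move=> imphi phi0; apply/lfunP => v;
    rewrite PiE pid // linearB /= (phi0 (p v)) ?subr0.
have Pi_im (phi : 'End(L)) v : Pi phi v \in N by rewrite PiE.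
have Pi_ker (phi : 'End(L)) v : v \in N -> Pi phi v = 0.
  by move=> vN; rewrite PiE (pid v) // subrr !linear0.
have act_lin x : linear (act x).
  move=> a phi psi; apply/lfunP => v.
  rewrite add_lfunE scale_lfunE !actE !add_lfunE !scale_lfunE linearPl.
  by rewrite scalerBr opprD addrACA.
have act_lin' phi : linear (act^~ phi).
  move=> a x y; apply/lfunP => v.
  rewrite add_lfunE scale_lfunE !actE /= linearP /= !linearPr linearP /=.
  by rewrite scalerBr opprD addrACA.
have act_b x y phi : act (sub_bracket br x y) phi
  = act y (act x phi) - act x (act y phi).
  apply/lfunP => v; rewrite lfunBE !actE val_sub_bracket !leib linearB /=.
  rewrite !linearBl /=.
  have aux (V : zmodType) (c1 c2 c3 c4 c5 c6 : V) :
      c1 - c2 - (c3 - c4) = c1 - c5 - (c6 - c4) - (c2 - c6 - (c5 - c3)).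
    rewrite !opprB [RHS]addrACA !subrKA [LHS]addrACA [RHS]addrACA.
    by rewrite [- c2 - c3]addrC.
  exact: aux.
have fixact x phi : Pi phi = phi -> Pi (act x phi) = act x phi.
  move=> fphi; apply: Pi_fix => v.
    by rewrite actE -fphi rpredB ?Pi_im // subN ?Pi_im ?subvsP.
  by move=> vN; rewrite actE -fphi !Pi_ker ?linear0l ?subr0 // subN ?subvsP.
have PiPi (phi : 'End(L)) : Pi (Pi phi) = Pi phi by apply: Pi_fix => v;
  [apply: Pi_im | apply: Pi_ker].
have [||||||||w [Piw wP]] :=
  @whitehead _ _ _ sub_bracket_simple 'End(L) act Pi (act^~ p).
- exact: act_lin.
- exact: act_lin'.
- exact: act_lin'.
- exact: act_b.
- exact: PiPi.
- by move=> x phi; apply/fixact/PiPi.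
- move=> x; apply: Pi_fix => v; first by rewrite actE rpredB // subN ?subvsP.
  by move=> vN; rewrite actE !pid ?subrr // subN ?subvsP.
- by move=> x y; apply: act_b.
pose q := p - w.
have qE v : q v = p v - w v by rewrite lfunBE.
have qid v : v \in N -> q v = v.
  by move=> vN; rewrite qE pid // -Piw Pi_ker // subr0.
have qN v : q v \in N by rewrite qE rpredB // -Piw Pi_im.
have qR v x : x \in G -> q (br v x) = br (q v) x.
  move=> xG; have := wP (vsproj G x) => /lfunP/(_ v);
    rewrite !actE vsprojK // => e.
  have epv : br (p v) x = br (w v) x - w (br v x) + p (br v x)
    by rewrite -e subrK.
  by rewrite !qE linearBl /= epv -[X in _ = X - _]addrA
    [RHS]addrAC subrr add0r addrC.
exists (M :&: lker q)%VS; split.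
- move=> v x; rewrite !memv_cap !memv_ker => /andP[vM /eqP qv] xG.
  by rewrite subM //= qR // qv linear0l.
- apply/eqP; rewrite eqEsubv subv_add NM capvSl /=; apply/subvP => v vM.
  rewrite -[v](subrKC (q v)) memv_add ?qN // memv_cap rpredB
    ?(subvP NM _ (qN v)) //=.
  by rewrite memv_ker linearB /= (qid (q v)) ?subrr.
apply/vspaceP => v; rewrite !memv_cap memv_ker memv0.
apply/idP/eqP => [/and3P[vN _]|->]; first by rewrite qid // => /eqP.
by rewrite !mem0v linear0 eqxx.
Qed.

(** Induction on the dimension: a nonzero proper submodule and its complement are both smaller. The
    zero module is the empty sum. *)
Lemma irreducible_decomposition_exists (M : {vspace L}) :
  right_submodule br G M ->
  exists (s : nat) (Is : 'I_s -> {vspace L}),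
    irreducible_decomposition br G M Is.
Proof.
have [k] := ubnP (\dim M); elim: k M => // k IHk M dM subM.
have [M0|M0] := eqVneq M 0%VS.
  exists 0%N, (fun=> 0%VS); split; rewrite ?big_ord0 //; last by case.
  by apply/directvP; rewrite /= !big_ord0 dimv0.
have [|noN] := pselect (exists N,
    [/\ (N <= M)%VS, right_submodule br G N, N != 0%VS & N != M]); last first.
  exists 1%N, (fun=> M); split; first by rewrite big_ord1.
    by apply/directvP; rewrite /= !big_ord1.
  move=> _; split=> // [|N NM subN]; first exact/eqP.
  have [->|N0] := eqVneq N 0%VS; first by left.
  by have [->|NneM] := eqVneq N M; [right | case: noN; exists N].
move=> [N [NM subN N0 NneM]].
have [N' [subN' NN' N0']] := submodule_complement subM subN NM.
have := dimv_disjoint_sum N0'; rewrite NN' => dimM.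
have dN : (\dim N < \dim M)%N by rewrite (ltn_leqif (dimv_leqif_eq NM)).
have dN0 : (0 < \dim N)%N by rewrite lt0n dimv_eq0.
have [s [Ns [sumN dirN irrN]]] := IHk N ltac:(lia) subN.
have [t [Ns' [sumN' dirN' irrN']]] := IHk N' ltac:(lia) subN'.
exists (s + t)%N, (fun i => match split i with inl j => Ns j
  | inr j => Ns' j end).
have splitl j : split (lshift t j) = inl j :> 'I_s + 'I_t
  by rewrite -[lshift _ _]/(unsplit (inl j)) unsplitK.
have splitr j : split (rshift s j) = inr j :> 'I_s + 'I_t
  by rewrite -[rshift _ _]/(unsplit (inr j)) unsplitK.
split.
- rewrite big_split_ord /= -NN' -sumN -sumN'; congr (_ + _)%VS;
  apply: eq_bigr => j _.
    by rewrite splitl.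
  by rewrite splitr.
- move/directvP: dirN; move/directvP: dirN'; rewrite /= sumN sumN' => dN' dN1.
  apply/directvP => /=; rewrite !big_split_ord /=.
  rewrite (eq_bigr Ns) => [|j _]; last by rewrite splitl.
  rewrite (eq_bigr Ns') => [|j _]; last by rewrite splitr.
  rewrite (eq_bigr (fun j => \dim (Ns j))) => [|j _]; last by rewrite splitl.
  rewrite (eq_bigr (fun j => \dim (Ns' j))) => [|j _]; last by rewrite splitr.
  by rewrite sumN sumN' NN' dimM dN' dN1.
by move=> i; case: (split i).
Qed.

End LeibnizModules.

(** * Derivations *)

(** A nonzero generalized eigenvector of [phi] in [M] yields an eigenvector, as the last nonzero
    iterate of [phi - mu]. The eigenspace in [M] is then a nonzero submodule, hence [M]. *)
Lemma schur (F : closedFieldType) (L : vectType F) (br : {bilinear L -> L -> L})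
    (G M : {vspace L}) (phi : 'End(L)) :
  irreducible_module br G M -> (forall x, x \in M -> phi x \in M) ->
  (forall x y, x \in M -> y \in G -> phi (br x y) = br (phi x) y) ->
  exists la, forall x, x \in M -> phi x = la *: x.
Proof.
move=> [subM /eqP M0 irrM] phiM phi_br.
pose psi : 'End(subvs_of M) := linfun (vsproj M \o phi \o vsval).
have psiE u : vsval (psi u) = phi (vsval u)
  by rewrite lfunE /= vsprojK // phiM ?subvsP.
have [rs [w [k [vw w0]]]] := primary_decomposition psi (vsproj M (vpick M)).
have [mu wmu] : exists mu, w mu != 0.
  apply: contrapT => nw; have : vpick M != 0 by rewrite vpick0.
  rewrite -(vsprojK (memv_pick M)) vw big1 ?linear0 ?eqxx // => mu _.
  by apply: contra_notP nw => /eqP; exists mu.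
have ex_i : exists i, iter i (fun u => psi u - mu *: u) (w mu) == 0
  by exists k; rewrite w0.
case: (ex_minnP ex_i) => -[|i]; first by rewrite /= (negPf wmu).
rewrite iterS; set u := iter i _ _ => /eqP psi_u min_i.
have u0 : u != 0 by apply: contraT => /negPn /min_i; rewrite ltnn.
exists mu; pose N := (M :&: lker (phi - mu *: \1%VF))%VS.
have memN x : (x \in N) = (x \in M) && (phi x == mu *: x).
  by rewrite memv_cap memv_ker lfunBE scale_lfunE id_lfunE subr_eq0.
have [|N0|NM] := irrM N (capvSl _ _).
- move=> x y; rewrite !memN => /andP[xM /eqP phi_x] yG.
  by rewrite subM //= phi_br // phi_x linearZl_LR.
- have : vsval u \in N.
    have psi_mu : psi u = mu *: u by apply/eqP; rewrite -subr_eq0; apply/eqP.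
    by rewrite memN subvsP -psiE psi_mu linearZ eqxx.
  rewrite N0 memv0 => /eqP val_u0; case/eqP: u0; apply: (can_inj vsvalK).
  by rewrite val_u0 linear0.
by move=> x; rewrite -{1}NM memN => /andP[_ /eqP].
Qed.

(** * Decomposition of derivations when [G] is simple *)

Section SemisimpleLeibniz.

Variables (F : numClosedFieldType) (L : vectType F).
Variables (br : {bilinear L -> L -> L}).
Variables (I G : {vspace L}).
Hypotheses (leib : right_leibniz br) (sqI : squares_ideal br I).
Hypotheses (simpleG : simple_lie_subalgebra br G) (GI : complementary G I).

(** The elements [y] with [[L, y] = 0] form an ideal, which contains the squares since [[t, [z, z]]
    = [[t, z], z] - [[t, z], z]]. *)
Lemma squares_ideal_annihilates x y : y \in I -> br x y = 0.
Proof.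
have [J JP] : exists J : {vspace L}, forall y, y \in J <-> forall x, br x y = 0.
  apply: vspace_of_linear => [z|a u v u0 v0 z]; first by rewrite linear0.
  by rewrite linearPr u0 v0 scaler0 addr0.
have [_ _ minI] := sqI; move=> yI; have /JP-> // : y \in J.
apply: (subvP (minI J _ _)) => // [|z]; last by apply/JP => t;
  rewrite leib subrr.
split=> [|u v _ /JP v0]; first exact: subvf.
by split; apply/JP => t; rewrite leib !v0 ?linear0l subrr.
Qed.

(** The elements of [I] that [d] sends into [I] form an ideal; it contains the squares because [d
    [z, z] = [d z, z] + [z, d z]] is, by polarization, a combination of squares. *)
Lemma derivation_squares_ideal (d : 'End(L)) x :
  derivation br d -> x \in I -> d x \in I.
Proof.
move=> d_br; have [[_ idI] sq minI] := sqI.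
suff /subvP IJ : (I <= I :&: d @^-1: I)%VS by move/IJ;
  rewrite memv_cap -memv_preim => /andP[].
apply: minI => [|z].
  split=> [|u v _]; first exact: subvf.
  rewrite !memv_cap -!memv_preim => /andP[vI dvI]; rewrite !d_br.
  have [uv vu] := idI u v (memvf _) vI;
    have [duv vdu] := idI (d u) v (memvf _) vI.
  have [udv dvu] := idI u (d v) (memvf _) dvI.
  by split; rewrite ?uv ?vu rpredD.
rewrite memv_cap sq -memv_preim d_br /=.
have -> : br (d z) z + br z (d z)
  = br (d z + z) (d z + z) - br (d z) (d z) - br z z.
  rewrite linearDl !linearD /= (addrC (br (d z) (d z))) addrACA.
  by rewrite -[RHS]addrA -opprD addrK.
by rewrite !rpredB.
Qed.

Lemma derivation_decomposition (d : 'End(L)) : derivation br d ->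
  exists (a : L) (alpha delta : 'End(L)), derivation_rep br G I d a alpha delta.
Proof.
move=> d_br; have [idI _ _] := sqI; have [GIT GI0] := GI.
have IG0 : (I :&: G)%VS = 0%VS by rewrite capvC.
have [[closedG _ _] _ _] := simpleG.
have [piG_br _ kerpi] := complement_quotient idI GI closedG.
have memI x : (x \in I) = (daddv_pi G I x == 0) by rewrite -{1}kerpi memv_ker.
have dec x : daddv_pi G I x + daddv_pi I G x = x by apply: daddv_pi_add => //;
  rewrite GIT memvf.
have piG x : daddv_pi G I x \in G by apply: memv_pi.
have piI x : daddv_pi I G x \in I by apply: memv_pi.
have piGid x : x \in G -> daddv_pi G I x = x by apply: daddv_pi_id.
have piIid x : x \in I -> daddv_pi I G x = x by apply: daddv_pi_id.
have piG0 x : x \in I -> daddv_pi G I x = 0 by rewrite memI => /eqP.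
have piI0 x : x \in G -> daddv_pi I G x = 0.
  by move=> xG; have := dec x; rewrite piGid // -[RHS]addr0 => /addrI.
pose D (x : subvs_of G) := vsproj G (daddv_pi G I (d (vsval x))).
have D_lin : linear D by move=> c x y; rewrite /D !linearP.
have [|a aP] := inner_derivation (sub_bracket_simple leib simpleG) D_lin.
  move=> x y; apply: (can_inj vsvalK);
    rewrite linearD /= !val_sub_bracket // /D !vsprojK //.
  - by rewrite d_br linearD /= !piG_br !(piGid (vsval _)) ?subvsP.
  - by rewrite closedG ?subvsP.
  by rewrite closedG ?subvsP.
pose R : 'End(L) := linfun (applyr br (vsval a)).
have RE x : R x = br x (vsval a) by rewrite lfunE.
(* Both maps preserve [I], and on [G] they agree modulo [I] by the choice of [a]. The restrictions
   of [d - R] to [I] and to [G] are [alpha] and [delta]. *)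
have dRI x : d x - R x \in I.
  rewrite -(dec x); set g := daddv_pi G I x; set i := daddv_pi I G x.
  rewrite [d _]linearD [R _]linearD /= opprD addrACA rpredD //; last first.
    apply: rpredB; first exact: (derivation_squares_ideal d_br (piI x)).
    rewrite RE.
    by have [_ /(_ (vsval a) i (memvf _) (piI x))[]] := idI.
  rewrite memI linearB /= RE [X in _ - X]piGid ?closedG ?subvsP ?piG //.
  have := congr1 vsval (aP (vsproj G g)).
  by rewrite /= val_sub_bracket // /D !vsprojK ?piG // => ->; rewrite subrr.
exists (vsval a), ((d - R) \o daddv_pi I G)%VF, ((d - R) \o daddv_pi G I)%VF;
  split.
- exact: subvsP.
- split=> x xI; rewrite comp_lfunE; first by rewrite piIid // lfunBE dRI.
  by rewrite piI0 // linear0.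
- split=> x xI; rewrite comp_lfunE; first by rewrite lfunBE dRI.
  by rewrite piG0 // linear0.
- move=> x; rewrite !comp_lfunE /right_mul -RE -addrA -linearD /=.
  rewrite [_ + daddv_pi G I x]addrC dec.
  by rewrite lfunBE subrKC.
move=> x y; rewrite !comp_lfunE !lfunBE.
have -> : daddv_pi I G (br x y) = br (daddv_pi I G x) y.
  rewrite -{1}(dec x) -{1}(dec y) linearDl /= [br _ (_ + _)]linearD /=.
  rewrite [br _ (daddv_pi I G y)]squares_ideal_annihilates // addr0 linearD /=
    dec.
  rewrite piI0 ?closedG // add0r piIid //.
  by have [_ /(_ y _ (memvf _) (piI x))[]] := idI.
set i := daddv_pi I G x.
rewrite d_br !RE linearBl /=.
(* [d y] and [[y, a]] differ by an element of [I], which right multiplication does not see; the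
   Leibniz identity then turns [[i, [y, a]]] into [[[i, y], a] - [[i, a], y]]. *)
have -> : br i (d y) = br i (br y (vsval a)).
  apply/eqP; rewrite -subr_eq0 -linearB /= squares_ideal_annihilates //.
  by rewrite -RE dRI.
by rewrite leib addrA addrAC addrK.
Qed.

Lemma derivation_components (d : 'End(L)) a alpha delta s
    (Is : 'I_s -> {vspace L}) :
  derivation_rep br G I d a alpha delta ->
  irreducible_decomposition br G I Is ->
  exists (alpha_ : 'I_s -> 'I_s -> 'End(L)) (lambda : 'I_s -> F),
    components G Is alpha alpha_ /\
    forall i x, x \in Is i -> alpha_ i i x = lambda i *: x.
Proof.
move=> [_ [alphaI alphaG] _ _ alpha_br] [sumI /directv_sum_unique uniqI irrI].
have [GIT GI0] := GI.
have IG0 : (I :&: G)%VS = 0%VS by rewrite capvC.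
have dec x : daddv_pi G I x + daddv_pi I G x = x by apply: daddv_pi_add => //;
  rewrite GIT memvf.
have IsI i x : x \in Is i -> x \in I.
  by move=> xi; rewrite -sumI (subvP (sumv_sup i _ (subvv _))).
(* The projection onto [Is i] along [G] and the other summands. By uniqueness of components it
   commutes with the action of [G] on [I], so each block [P i \o alpha \o P i] falls under Schur's
   lemma. *)
pose P i : 'End(L) := (sumv_pi_for (esym sumI) i \o daddv_pi I G)%VF.
have PIs i x : P i x \in Is i by rewrite comp_lfunE memv_sum_pi.
have sumP x : \sum_i P i x = daddv_pi I G x.
  under eq_bigr => i _ do rewrite comp_lfunE.
  by rewrite sumv_pi_sum ?memv_pi.
have uniqP i x (us : 'I_s -> L) : (forall j, us j \in Is j) ->
    daddv_pi I G x = \sum_j us j -> P i x = us i.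
  move=> us_Is; rewrite -sumP => /eqP.
  by rewrite uniqI // => /forallP/(_ i)/eqP.
have PI i k x : x \in Is k -> P i x = if i == k then x else 0.
  move=> xk; apply: (uniqP i x (fun j => if j == k then x else 0)) => [j|].
    by case: eqP => [->|_]; rewrite ?mem0v.
  by rewrite -big_mkcond big_pred1_eq daddv_pi_id // (IsI k).
have PG i x : x \in G -> P i x = 0.
  move=> xG; apply: (uniqP i x (fun=> 0)) => [j|]; first exact: mem0v.
  have := dec x; rewrite big1 // daddv_pi_id // -[RHS]addr0.
  exact: addrI.
have P_br i x y : x \in I -> y \in G -> P i (br x y) = br (P i x) y.
  move=> xI yG; apply: (uniqP i _ (fun j => br (P j x) y)) => [j|].
    by have [subIs _ _] := irrI j; apply: subIs.
  rewrite -linear_sumlz sumP !daddv_pi_id //.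
  by have [[_ /(_ y x (memvf _) xI)[]]] := sqI.
pose alpha_ i j : 'End(L) := (P j \o alpha \o P i)%VF.
have alphaE i j x : alpha_ i j x = P j (alpha (P i x)) by rewrite !comp_lfunE.
have /boolp.choice[lambda lambdaP] :
    forall i, exists la, forall x, x \in Is i -> alpha_ i i x = la *: x.
  move=> i; apply: (schur (irrI i)) => [x xi|x y xi yG].
    by rewrite alphaE.
  have xI := IsI _ _ xi; have PxI := IsI _ _ (PIs i x).
  by rewrite !alphaE P_br // alpha_br P_br // alphaI.
exists alpha_, lambda; split=> //; split.
- by move=> i j x _; rewrite alphaE.
- by move=> i j k x ki xk;
  rewrite alphaE (PI i k x) // eq_sym (negPf ki) !linear0.
- by move=> i j x xG; rewrite alphaE (PG i) // !linear0.
apply/lfunP => x; rewrite sum_lfunE.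
transitivity (\sum_i alpha (P i x)).
  by rewrite -linear_sum /= sumP -{1}(dec x) linearD /= alphaG ?add0r ?memv_pi.
apply: eq_bigr => i _; rewrite sum_lfunE.
under eq_bigr => j _ do rewrite alphaE.
by rewrite sumP daddv_pi_id // alphaI // (IsI i).
Qed.

End SemisimpleLeibniz.

Theorem theorem3p7 (R : realType) (L : vectType R[i])
    (br : {bilinear L -> L -> L}) (I G : {vspace L}) :
  right_leibniz br ->
  semisimple_leibniz br ->
  squares_ideal br I ->
  simple_lie_subalgebra br G ->
  complementary G I ->
  (exists (s : nat) (Is : 'I_s -> {vspace L}),
     irreducible_decomposition br G I Is) /\
  forall d : 'End(L), derivation br d ->
    exists (a : L) (alpha delta : 'End(L)),
      derivation_rep br G I d a alpha delta /\
      forall (s : nat) (Is : 'I_s -> {vspace L}),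
        irreducible_decomposition br G I Is ->
        exists (alpha_ : 'I_s -> 'I_s -> 'End(L)) (lambda : 'I_s -> R[i]),
          components G Is alpha alpha_ /\
          forall i x, x \in Is i -> alpha_ i i x = lambda i *: x.
Proof.
move=> leib _ sqI simpleG GI; split.
  apply: irreducible_decomposition_exists => // x g xI _.
  by have [[_ idI] _ _] := sqI; have [] := idI g x (memvf _) xI.
move=> d d_br.
have [a [alpha [delta d_rep]]] :=
  derivation_decomposition leib sqI simpleG GI d_br.
exists a, alpha, delta; split=> // s Is decI.
exact: (derivation_components sqI GI d_rep decI).
Qed.
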